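(* Let $H_{27}$ be the Heisenberg group of order $27$, i.e. the group of unitriangular $3\times 3$ matrices over the field with $3$ elements. Then $\mathsf{D}(H_{27})\ge 8$.
   Context: For a finite group $G$, a sequence over $G$ is a finite multiset of elements of $G$ (an element of the free abelian monoid $\mathcal{F}(G)$ on the set $G$); its length is the number of its terms counted with multiplicity. A sequence is a product-one sequence if the product of its terms in some order equals $1_G$ (the empty sequence is product-one). Product-one sequences form a submonoid $\mathcal{B}(G)$ of $\mathcal{F}(G)$. An atom is a non-empty product-one sequence that is not the product (multiset union) of two non-empty product-one sequences. The large Davenport constant $\mathsf{D}(G)$ is the maximal length of an atom of $\mathcal{B}(G)$. *)

(* Defs.v *)
From HB Require Import structures.
From mathcomp Require Import all_boot all_order all_algebra all_fingroup.
From mathcomp Require Import finmap multiset.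
From mathcomp Require Import boolp.

Set Implicit Arguments.
Unset Strict Implicit.
Unset Printing Implicit Defensive.

Section Sequences.
Local Open Scope group_scope.
Local Open Scope mset_scope.

Variable gT : finGroupType.
Implicit Types (G : {group gT}) (A B C : {mset gT}) (s : seq gT).

(* The free abelian monoid F(G) consists of the finite multisets A : {mset gT}
   with {subset A <= G}; its operation is the multiset sum `+` and the length
   of A is size A, the number of terms counted with multiplicity. *)

Definition product_one A : Prop :=
  exists2 s, perm_eq s A & \prod_(x <- s) x = 1.

(* B and C are not required to be over G: as parts of A they always are. *)
Definition is_atom G A : Prop :=
  [/\ {subset A <= G}, product_one A, A <> mset0
    & ~ exists B C, [/\ product_one B, product_one C,
                        B <> mset0, C <> mset0 & A = B `+` C]].

Definition atom_length G (n : nat) : bool :=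
  `[< exists2 A, is_atom G A & size A = n >].

Lemma size_mset_eq0 A : size A = 0%N -> A = mset0.
Proof.
move=> /size0nil A0; apply/msetP => x.
by rewrite -count_mem_mset A0 mset0E.
Qed.

Lemma seq_mset_neq0 s : (0 < size s)%N -> seq_mset s <> mset0.
Proof.
move=> s_gt0 s0; have := perm_size (perm_eq_seq_mset s).
by rewrite s0 enum_mset0 => e; rewrite -e in s_gt0.
Qed.

Lemma product_one_seq s : \prod_(x <- s) x = 1 -> product_one (seq_mset s).
Proof. by move=> s1; exists s; rewrite // perm_sym perm_eq_seq_mset. Qed.

Lemma atom_length_ex G : exists n, atom_length G n.
Proof.
exists 1%N; apply/asboolP; exists [mset 1]; last by rewrite enum_msetn.
split.
- by move=> x; rewrite in_mset1 => /eqP ->; exact: group1.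
- by exists [:: 1]; rewrite ?big_seq1 // enum_msetn.
- by move=> /msetP/(_ 1); rewrite msetnxx mset0E.
- move=> [B [C [_ _ B0 C0 /(congr1 (fun A => A : seq gT)) e]]].
  have sz : size [mset (1 : gT)] = (size B + size C)%N.
    rewrite e -size_cat; apply: perm_size; apply/allP => x _ /=.
    by rewrite count_cat !count_mem_mset msetE2.
  have B1 : (0 < size B)%N by rewrite lt0n; apply/eqP => /size_mset_eq0.
  have C1 : (0 < size C)%N by rewrite lt0n; apply/eqP => /size_mset_eq0.
  by have := leq_add B1 C1; rewrite -sz enum_msetn.
Qed.

Lemma atom_length_bound G n : atom_length G n -> (n <= #|G|)%N.
Proof.
move=> /asboolP[A [sAG [s sA s1] _ indec] <-]; rewrite leqNgt -(perm_size sA).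
apply/negP => ltGs; apply: indec.
have sG x : x \in s -> x \in G by rewrite (perm_mem sA); apply: sAG.
pose P (k : 'I_(size s)) := \prod_(x <- take k s) x.
have PG k : P k \in G.
  by rewrite /P big_seq; apply: group_prod => x /mem_take /sG.
have : ~~ injectiveb P.
  apply/negP => /injectiveP injP; move: ltGs; rewrite ltnNge => /negP; apply.
  rewrite -[X in (X <= _)%N](card_ord (size s)) -(card_image injP).
  by apply: subset_leq_card; apply/subsetP => _ /imageP[k _ ->].
move=> /injectivePn[i0 [j0 neq eqP0]].
have [i [j [ltij eqP]]] : exists i j : 'I_(size s), (i < j)%N /\ P i = P j.
  have [lt|lt|/val_inj e] := ltngtP i0 j0.
  - by exists i0, j0.
  - by exists j0, i0.
  - by rewrite e eqxx in neq.
pose m := drop i (take j s); pose r := take i s ++ drop j s.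
have tj : take j s = take i s ++ m.
  by rewrite -[LHS](cat_take_drop i) take_takel // ltnW.
have m1 : \prod_(x <- m) x = 1.
  by apply: (mulgI (P i)); rewrite mulg1 [RHS]eqP /P tj big_cat.
have r1 : \prod_(x <- r) x = 1.
  by rewrite /r big_cat /= -/(P i) eqP /P -big_cat cat_take_drop.
exists (seq_mset m), (seq_mset r); split; try exact: product_one_seq.
- apply: seq_mset_neq0.
  by rewrite size_drop size_takel ?subn_gt0 // ltnW // ltn_ord.
- apply: seq_mset_neq0.
  by rewrite size_cat size_drop addn_gt0 subn_gt0 ltn_ord orbT.
- apply/msetP => x; rewrite msetE2 !mset_seqE -count_mem_mset.
  rewrite -(seq.permP sA) -{1}(cat_take_drop j s) tj !count_cat.
  by rewrite addnCA addnA.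
Qed.

Definition large_davenport G : nat :=
  ex_maxn (atom_length_ex G) (@atom_length_bound G).

End Sequences.

Section Heisenberg.
Import GRing.Theory.
Local Open Scope ring_scope.

Definition unitriangular (R : pzSemiRingType) n (M : 'M[R]_n) : bool :=
  [forall i : 'I_n, forall j : 'I_n, (j <= i)%N ==> (M i j == (i == j)%:R)].

Definition heisenberg27_set : {set {'GL_3['F_3]}} :=
  [set u | unitriangular (GLval u)].

Lemma heisenberg27_group_set : group_set heisenberg27_set.
Proof.
have ut (M : 'M['F_3]_3) : reflect
    (forall i j : 'I_3, (j <= i)%N -> M i j = (i == j)%:R) (unitriangular M).
  apply: (iffP forallP) => [h i j ij|h i].
    by have /forallP/(_ j)/implyP/(_ ij)/eqP := h i.
  by apply/forallP => j; apply/implyP => ij; apply/eqP/h.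
apply/group_setP; split.
  by rewrite inE; apply/ut => i j _; rewrite GL_1E mxE.
move=> u v; rewrite !inE => /ut hu /ut hv; apply/ut => i j ji.
rewrite GL_ME mxE (bigD1 i) //= hu // eqxx mul1r hv // big1 ?addr0 // => k ki.
case: (ltngtP k i) => [lt|gt|/val_inj e]; last by rewrite e eqxx in ki.
- by rewrite hu ?(ltnW lt) // eq_sym (negbTE ki) mul0r.
- have jk : (j < k)%N by apply: leq_ltn_trans gt.
  rewrite hv ?(ltnW jk) //; case: eqP => [e|_]; last by rewrite mulr0.
  by rewrite e ltnn in jk.
Qed.

Definition heisenberg27 : {group {'GL_3['F_3]}} := Group heisenberg27_group_set.

End Heisenberg.

(* Main.v *)
Require Import Defs.
From mathcomp Require Import all_boot.
From mathcomp Require Import all_algebra all_fingroup.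
From mathcomp Require Import multiset boolp ring zify.

(** Let [x] and [y] be the elementary unitriangular matrices with a single
    off-diagonal entry in positions (0, 1) and (1, 2), and let
    [z = x^-1 * y^-1 * x * y] be the central one with that entry in position
    (0, 2).  The atom of length 8 is the multiset with [x] and [y] taken three
    times and [z] twice; more generally, for [n > 1], [n] copies of
    [x] and [y] and [n - 1] copies of [z] form an atom as soon as [x], [y], [z] generate a copy of the
    Heisenberg group modulo [n] ([atom_length_heisenberg_triple]).

    It is product-one because reordering can create a commutator:
    [y^(n-1) x y x^(n-1) = y^-1 x y x^-1 = z] cancels [z^(n-1)].

    It is indecomposable because creating a commutator needs both [x] and [y].
    Collecting a word into the form [x^i y^j z^k] ([collect]), one sees that a
    product-one word has its numbers of [x] and of [y] divisible by [n], and
    its number of [z] as well when [x] or [y] does not occur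
    ([dvdn_count_product_one]).  In a factorisation into two product-one parts,
    all copies of [x] therefore lie in the same part, and so do all copies
    of [y].  If a single part gets both letters, the other one is a power of
    [z] of exponent less than [n] and divisible by [n], hence empty.  Otherwise
    both parts have a number of [z] divisible by [n], which is impossible as
    these numbers add up to [n - 1]. *)

Set Implicit Arguments.
Unset Strict Implicit.
Unset Printing Implicit Defensive.

(** * An atom of length 3n - 1 from a Heisenberg triple *)

Section HeisenbergTriple.
Local Open Scope mset_scope.
Local Open Scope group_scope.

Variables (gT : finGroupType) (n : nat) (x y z : gT).
Hypothesis n_gt1 : (1 < n)%N.
Hypotheses (xn : x ^+ n = 1) (yn : y ^+ n = 1) (zn : z ^+ n = 1).
Hypotheses (xz : commute x z) (yz : commute y z).
Hypothesis xyz : x * y = y * x * z.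
(* The n^3 collected words are pairwise distinct. *)
Hypothesis free_xyz : forall i j k, x ^+ i * y ^+ j * z ^+ k = 1 ->
  [/\ (n %| i)%N, (n %| j)%N & (n %| k)%N].

Let expg_predn (u : gT) : u ^+ n = 1 -> u ^+ n.-1 = u^-1.
Proof.
by move=> un; apply: (mulgI u); rewrite -expgS prednK ?un ?mulgV // ltnW.
Qed.

(** Distinctness is what lets multiplicities be read off with [count_mem]. *)
Lemma heisenberg_triple_neq : [/\ x != y, x != z & y != z].
Proof.
have n1 : (n %| 1)%N = false by rewrite dvdn1; apply/eqP; lia.
split; apply/eqP => e.
- have [] := @free_xyz 1 n.-1 0; last by rewrite n1.
  by rewrite expg_predn // e expg1 mulgV mul1g.
- have [] := @free_xyz 1 0 n.-1; last by rewrite n1.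
  by rewrite expg_predn // e expg1 mulg1 mulgV.
- have [] := @free_xyz 0 1 n.-1; last by rewrite n1.
  by rewrite expg_predn // e expg1 mul1g mulgV.
Qed.

Lemma mulg_expX i : y * x ^+ i = x ^+ i * y * z ^+ (n.-1 * i).
Proof.
have yx : y * x = x * y * z ^+ n.-1 by rewrite expg_predn // xyz mulgK.
elim: i => [|i IH]; first by rewrite muln0 !mulg1 mul1g.
have zxi : commute (z ^+ n.-1) (x ^+ i) by apply: commuteX2; apply: commute_sym.
rewrite expgS mulgA yx -mulgA zxi mulgA -(mulgA x) IH mulnSr expgD.
by rewrite !mulgA.
Qed.

(** Moving [y] to the right of [x] is the only operation that changes the
    exponent of [z], which is why the correction [t] vanishes on words where
    one of the two letters is missing. *)
Lemma collect s : {subset s <= [:: x; y; z]} ->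
  exists2 t, \prod_(u <- s) u =
    x ^+ count_mem x s * y ^+ count_mem y s * z ^+ (count_mem z s + t)
  & (count_mem x s * count_mem y s = 0)%N -> t = 0%N.
Proof.
have [/negPf nxy /negPf nxz /negPf nyz] := heisenberg_triple_neq.
elim: s => [|u s IH] sub; first by exists 0%N; rewrite // big_nil !mulg1.
have [v vs|t IHp t0] := IH; first by apply: sub; rewrite inE vs orbT.
rewrite big_cons IHp /=.
have := sub u (mem_head _ _); rewrite !inE => /or3P[] /eqP ->.
- rewrite eqxx nxy nxz add0n add1n; exists t => [|/eqP]; last first.
    by rewrite muln_eq0 /= => /eqP y0; rewrite t0 // y0 muln0.
  by rewrite expgS !mulgA.
- rewrite eq_sym nxy eqxx nyz !add0n add1n.
  exists (n.-1 * count_mem x s + t)%N => [|/eqP]; last first.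
    by rewrite muln_eq0 orbF => /eqP x0; rewrite t0 x0 ?muln0.
  have zy : commute (z ^+ (n.-1 * count_mem x s)) (y ^+ count_mem y s).
    by apply: commuteX2; apply: commute_sym.
  rewrite 2!mulgA mulg_expX addnCA !expgD expgS -!mulgA.
  by rewrite (mulgA (z ^+ (_ * _))) zy !mulgA.
- rewrite !(eq_sym z) nxz nyz eqxx !add0n add1n; exists t => //.
  have zxy : commute z (x ^+ count_mem x s * y ^+ count_mem y s).
    by apply: commuteM; apply: commuteX; apply: commute_sym.
  by rewrite addSn expgS mulgA zxy mulgA.
Qed.

(** The atom has n - 1 copies of z, so the last divisibility is what prevents
    a part without x or without y from containing any z. *)
Lemma dvdn_count_product_one s :
    {subset s <= [:: x; y; z]} -> \prod_(u <- s) u = 1 ->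
  [/\ (n %| count_mem x s)%N, (n %| count_mem y s)%N
    & (count_mem x s * count_mem y s = 0)%N -> (n %| count_mem z s)%N].
Proof.
move=> /collect[t -> t0] /free_xyz[nx ny nz]; split=> // xy0.
by rewrite t0 ?addn0 in nz.
Qed.

(* An ordering of the atom in which one commutator of x and y appears. *)
Let word := nseq n.-1 y ++ [:: x; y] ++ nseq n.-1 x ++ nseq n.-1 z.

Let prod_word : \prod_(u <- word) u = 1.
Proof.
rewrite !big_cat !big_cons big_nil !big_nseq !iter_mulg_1 /= mulg1.
by rewrite !expg_predn // xyz !mulgA mulVg mul1g xz mulgK mulgV.
Qed.

Let count_word u :
  count_mem u word = (n * (x == u) + n * (y == u) + n.-1 * (z == u))%N.
Proof.
rewrite !count_cat !count_nseq /= addn0.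
by case: (x == u) (y == u) (z == u) => [] [] []; lia.
Qed.

Lemma atom_length_heisenberg_triple (G : {group gT}) :
  x \in G -> y \in G -> atom_length G (3 * n).-1.
Proof.
move=> xG yG; have zG : z \in G.
  have -> : z = (y * x)^-1 * (x * y) by rewrite xyz mulKg.
  by rewrite groupM ?groupV ?groupM.
have [/negPf nxy /negPf nxz /negPf nyz] := heisenberg_triple_neq.
apply/asboolP; exists (seq_mset word); last first.
  rewrite (perm_size (perm_eq_seq_mset _)) !size_cat !size_nseq /=; lia.
split.
- move=> u; rewrite (perm_mem (perm_eq_seq_mset _)) !mem_cat !mem_nseq !inE.
  by case/or4P=> [/andP[_]|/orP[]|/andP[_]|/andP[_]] /eqP ->.
- exact: product_one_seq prod_word.
- by apply: seq_mset_neq0; rewrite !size_cat addnCA.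
move=> [B [C [[s sB s1] [r rC r1] B0 C0 eBC]]].
have cnt u : (count_mem u s + count_mem u r)%N =
             (n * (x == u) + n * (y == u) + n.-1 * (z == u))%N.
  rewrite -count_word -[RHS]mset_seqE eBC msetE2 -!count_mem_mset.
  by rewrite (seq.permP sB) (seq.permP rC).
have sub u : (0 < count_mem u s + count_mem u r)%N -> u \in [:: x; y; z].
  rewrite cnt !inE !(eq_sym u).
  by case: (x == u) (y == u) (z == u) => [] [] [] //; rewrite !muln0.
have subs : {subset s <= [:: x; y; z]}.
  by move=> u us; apply: sub; rewrite addn_gt0 -!has_count has_pred1 us.
have subr : {subset r <= [:: x; y; z]}.
  by move=> u ur; apply: sub; rewrite addn_gt0 -!has_count !has_pred1 ur orbT.
have empty (q : seq gT) (D : {mset gT}) : perm_eq q D ->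
    {subset q <= [:: x; y; z]} -> D <> mset0 ->
    (0 < count_mem x q + count_mem y q + count_mem z q)%N.
  case: q => [/perm_size/esym/Defs.size_mset_eq0 //|u q _ sq _].
  have := sq u (mem_head _ _); rewrite !inE => /or3P[] /eqP -> /=;
    rewrite eqxx; lia.
have s_gt0 := empty _ _ sB subs B0; have r_gt0 := empty _ _ rC subr C0.
have [nxs nys nzs] := dvdn_count_product_one subs s1.
have [nxr nyr nzr] := dvdn_count_product_one subr r1.
have := cnt x; have := cnt y; have := cnt z.
rewrite !eqxx nxy nxz nyz !(eq_sym y x) !(eq_sym z) nxy nxz nyz.
rewrite !(muln0, muln1, addn0, add0n) => cz cy cx.
(* The multiplicity of z in the word is less than n and those of x and y
   equal n, so divisibility by n leaves only extreme distributions. *)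
have small c : (n %| c)%N -> (c < n)%N -> c = 0%N.
  by case: c => // c nc lt; rewrite gtnNdvd in nc.
have part a b : (n %| a)%N -> (a + b = n)%N -> a = 0%N \/ b = 0%N.
  move=> na ab; have [/small|] := ltnP a n; first by left; auto.
  by rewrite -{1}ab -{2}[a]addn0 leq_add2l leqn0 => /eqP; right.
have part_z : (count_mem z s < n)%N /\ (count_mem z r < n)%N.
  by rewrite -(ltn_predK n_gt1) !ltnS -cz leq_addr leq_addl.
have zs0 : (count_mem x s * count_mem y s = 0)%N -> count_mem z s = 0%N.
  by move=> /nzs /small; apply; case: part_z.
have zr0 : (count_mem x r * count_mem y r = 0)%N -> count_mem z r = 0%N.
  by move=> /nzr /small; apply; case: part_z.
have n1_gt0 : (0 < n.-1)%N by rewrite ltn_predRL.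
case: (part _ _ nxs cx) (part _ _ nys cy) => [x0|x0] [y0|y0].
- by rewrite zs0 x0 y0 in s_gt0.
- by rewrite -cz zs0 ?x0 // zr0 ?y0 ?muln0 in n1_gt0.
- by rewrite -cz zs0 ?y0 ?muln0 // zr0 ?x0 in n1_gt0.
- by rewrite zr0 x0 y0 in r_gt0.
Qed.

End HeisenbergTriple.

Lemma atom_length_leq (gT : finGroupType) (G : {group gT}) n :
  atom_length G n -> (n <= large_davenport G)%N.
Proof. by rewrite /large_davenport; case: ex_maxnP => m _ max /max. Qed.

(** * The Heisenberg triple of unitriangular matrices over F_3 *)

Section UnitriangularMatrices.
Import GRing.Theory.
Local Open Scope ring_scope.

Definition ut_mx (R : nzRingType) (a b c : R) : 'M[R]_3 :=
  \matrix_(i, j)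
    nth 0 (nth [::] [:: [:: 1; a; c]; [:: 0; 1; b]; [:: 0; 0; 1]] i) j.

Lemma ut_mx_unitriangular (R : nzRingType) (a b c : R) :
  unitriangular (ut_mx a b c).
Proof.
apply/forallP => i; apply/forallP => j; rewrite mxE.
by case: i j => [[|[|[|//]]] ?] [[|[|[|//]]] ?] /=; rewrite ?eqxx.
Qed.

Lemma ut_mx0 (R : nzRingType) : ut_mx 0 0 0 = 1%:M :> 'M[R]_3.
Proof.
by apply/matrixP => -[[|[|[|//]]] ?] [[|[|[|//]]] ?]; rewrite !mxE.
Qed.

Lemma ut_mxM (R : comNzRingType) (a b c a' b' c' : R) :
  ut_mx a b c *m ut_mx a' b' c' = ut_mx (a + a') (b + b') (c + c' + a * b').
Proof.
apply/matrixP => -[[|[|[|//]]] ?] [[|[|[|//]]] ?];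
  rewrite !mxE !big_ord_recl big_ord0 !mxE /=; ring.
Qed.

Lemma ut_mx_unit (R : comUnitRingType) (a b c : R) : ut_mx a b c \in unitmx.
Proof.
suff /mulmx1_unit[]: ut_mx a b c *m ut_mx (- a) (- b) (a * b - c) = 1%:M by [].
by rewrite ut_mxM -ut_mx0; congr ut_mx; ring.
Qed.

Definition ut (a b c : 'F_3) : {'GL_3['F_3]} :=
  Sub (ut_mx a b c) (ut_mx_unit a b c).

Lemma ut_heisenberg27 a b c : ut a b c \in heisenberg27.
Proof. by rewrite inE; apply: ut_mx_unitriangular. Qed.

Lemma utM a b c a' b' c' :
  (ut a b c * ut a' b' c')%g = ut (a + a') (b + b') (c + c' + a * b').
Proof. by apply: val_inj; rewrite /= -ut_mxM. Qed.

Lemma ut0 : ut 0 0 0 = 1%g.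
Proof. by apply: val_inj; rewrite /= ut_mx0. Qed.

Lemma ut_inj a b c a' b' c' :
  ut a b c = ut a' b' c' -> [/\ a = a', b = b' & c = c'].
Proof.
move=> /(congr1 val)/matrixP e.
by split; [have := e 0 1 | have := e 1 2 | have := e 0 2]; rewrite !mxE.
Qed.

(** The condition [a * b = 0] removes the quadratic term of the power, in the
    corner entry; it holds for the three generators. *)
Lemma utX a b c n : a * b = 0 ->
  (ut a b c ^+ n)%g = ut (a *+ n) (b *+ n) (c *+ n).
Proof.
move=> ab0; elim: n => [|n IH]; first by rewrite !mulr0n ut0.
by rewrite expgS IH utM -!mulrS mulrnAr ab0 mul0rn addr0.
Qed.

Lemma atom_length_heisenberg27 : atom_length heisenberg27 8.
Proof.
have F3 n : (n%:R == 0 :> 'F_3) = (3 %| n)%N.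
  by rewrite (dvdn_pcharf (pchar_Fp (isT : prime 3))).
have F33 : 1 *+ 3 = 0 :> 'F_3 by apply/eqP; rewrite F3.
apply: (@atom_length_heisenberg_triple _ 3 (ut 1 0 0) (ut 0 1 0) (ut 0 0 1)).
- by [].
- by rewrite utX ?mulr0 // !mul0rn F33 ut0.
- by rewrite utX ?mul0r // !mul0rn F33 ut0.
- by rewrite utX ?mul0r // !mul0rn F33 ut0.
- by rewrite /commute !utM; congr ut; ring.
- by rewrite /commute !utM; congr ut; ring.
- by rewrite !utM; congr ut; ring.
- move=> i j k; rewrite !utX ?mul0r ?mulr0 // !utM !mul0rn -ut0 => /ut_inj[].
  rewrite !(addr0, add0r) => i0 j0.
  by rewrite j0 mulr0 !(addr0, add0r) -!F3 i0 j0 => ->.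
- exact: ut_heisenberg27.
- exact: ut_heisenberg27.
Qed.

End UnitriangularMatrices.

Theorem proposition5p5 : (8 <= large_davenport heisenberg27)%N.
Proof. exact: atom_length_leq atom_length_heisenberg27. Qed.
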